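(* Let $F:(M^{2(m+n+r)},g_M,J)\to(N^{n+2r},g_N)$ be a conformal semi-invariant submersion from a Kähler manifold $(M,g_M,J)$ to a Riemannian manifold $(N,g_N)$. If $n+2r=2$, then $F$ is harmonic if and only if the fibres of $F$ are minimal.
   Context: A Kähler manifold $(M,g_M,J)$ is a Riemannian manifold with a $(1,1)$-tensor $J$ such that $J^2=-I$, $g_M(JX,JY)=g_M(X,Y)$ and $\nabla^M J=0$, where $\nabla^M$ is the Levi-Civita connection. A smooth submersion $F:(M,g_M)\to(N,g_N)$ is horizontally conformal with dilation $\lambda$ ($\lambda$ a positive function on $M$) if $\lambda^2g_M(X,Y)=g_N(F_*X,F_*Y)$ for all $X,Y\in\Gamma((\ker F_* )^\perp)$. It is a conformal semi-invariant submersion if in addition there is a distribution $D_1\subseteq\ker F_*$ with $\ker F_*=D_1\oplus D_2$, $J(D_1)=D_1$, $J(D_2)\subseteq(\ker F_* )^\perp$, where $D_2$ is the orthogonal complement of $D_1$ in $\ker F_*$. Superscripts denote real dimensions: $\dim M=2(m+n+r)$, $\dim N=n+2r$, where $\dim D_1=2m$, $\dim D_2=n$, and the orthogonal complement $\mu$ of $JD_2$ in $(\ker F_* )^\perp$ has dimension $2r$. $F$ is harmonic if its tension field $\tau(F)=\mathrm{trace}(\nabla F_* )$ vanishes, where $(\nabla F_* )(X,Y)=\nabla^F_XF_*Y-F_*(\nabla^M_XY)$ and $\nabla^F$ is the pullback connection on $F^{-1}TN$. *)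

(* Defs.v *)
From HB Require Import structures.
From mathcomp Require Import all_boot all_order all_algebra.
From mathcomp Require Import all_classical all_reals all_analysis.
From mathcomp Require Import ring.
Set Implicit Arguments.
Unset Strict Implicit.
Unset Printing Implicit Defensive.
Import Order.TTheory GRing.Theory Num.Theory.
Import numFieldNormedType.Exports.
Local Open Scope classical_set_scope.
Local Open Scope ring_scope.

(* Conventions: tangent vectors are written in charts as row vectors, so the
   differential of f at x is v |-> v *m 'J f x, a (1,1)-tensor acts by
   v |-> v *m J, a metric is its Gram matrix G with g(u, v) = u G v^T, and a
   subspace of a tangent space is the row space of a matrix (scope %MS).
   A tensor field on a manifold is given by its components in every chart,
   as functions of the coordinates, subject to the transformation law. *)

Section Smooth.
Context {R : realType} {V W : normedModType R}.

(* Only meant for U open. *)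
Fixpoint Ck (k : nat) (U : set V) (f : V -> W) : Prop :=
  if k is k'.+1 then
    (forall x, U x -> differentiable f x) /\
    (forall v, Ck k' U (fun x => 'D_v f x))
  else forall x, U x -> {for x, continuous f}.

Definition smooth (U : set V) (f : V -> W) : Prop := forall k, Ck k U f.

End Smooth.

(* The atlas need not be maximal.  Outside [dom a] and [cod a] the values of
   [phi a] and [psi a] are irrelevant. *)
Record manifold (R : realType) (d : nat) := Manifold {
  carrier :> topologicalType;
  carrier_hausdorff : hausdorff_space carrier;
  carrier_second_countable : @second_countable carrier;
  atlas : Type;
  dom : atlas -> set carrier;
  cod : atlas -> set 'rV[R]_d;
  phi : atlas -> carrier -> 'rV[R]_d;
  psi : atlas -> 'rV[R]_d -> carrier;
  dom_open : forall a, open (dom a);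
  cod_open : forall a, open (cod a);
  phi_cod : forall a p, dom a p -> cod a (phi a p);
  psi_dom : forall a x, cod a x -> dom a (psi a x);
  phiK : forall a p, dom a p -> psi a (phi a p) = p;
  psiK : forall a x, cod a x -> phi a (psi a x) = x;
  phi_continuous : forall a p, dom a p -> {for p, continuous (phi a)};
  psi_continuous : forall a x, cod a x -> {for x, continuous (psi a)};
  dom_cover : forall p, exists a, dom a p;
  transition_smooth : forall a b,
    smooth [set x | cod a x /\ dom b (psi a x)] (fun x => phi b (psi a x))
}.

Section Tensors.
Context {R : realType} {d : nat} (M : manifold R d).

Definition overlap (a b : atlas M) : set 'rV[R]_d :=
  [set x | cod a x /\ dom b (psi a x)].

Definition transition (a b : atlas M) (x : 'rV[R]_d) : 'rV[R]_d :=
  phi b (psi a x).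

Record riemannian_metric := RiemannianMetric {
  gram :> atlas M -> 'rV[R]_d -> 'M[R]_d;
  gram_smooth : forall a, smooth (cod a) (gram a);
  gram_sym : forall a x, cod a x -> (gram a x)^T = gram a x;
  gram_pos : forall a x (u : 'rV[R]_d), cod a x -> u != 0 ->
    0 < (u *m gram a x *m u^T) 0 0;
  gram_transition : forall a b x, overlap a b x ->
    gram a x = 'J (transition a b) x *m gram b (transition a b x)
               *m ('J (transition a b) x)^T
}.

Record tensor11 := Tensor11 {
  endo :> atlas M -> 'rV[R]_d -> 'M[R]_d;
  endo_smooth : forall a, smooth (cod a) (endo a);
  endo_transition : forall a b x, overlap a b x ->
    endo a x *m 'J (transition a b) x =
    'J (transition a b) x *m endo b (transition a b x)
}.

Record distribution (k : nat) := Distribution {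
  fiber :> atlas M -> 'rV[R]_d -> 'M[R]_d;
  fiber_frame : forall a x, cod a x ->
    exists U : set 'rV[R]_d, exists B : 'rV[R]_d -> 'M[R]_(k, d),
    [/\ open U, U x, smooth U B &
     forall y, U y -> row_free (B y) /\ (fiber a y :=: B y)%MS];
  fiber_transition : forall a b x, overlap a b x ->
    (fiber a x *m 'J (transition a b) x :=: fiber b (transition a b x))%MS
}.

End Tensors.

Section LinearAlgebra.
Context {R : realType} {d : nat}.

Definition inner (G : 'M[R]_d) (u v : 'rV[R]_d) : R := (u *m G *m v^T) 0 0.

Definition perp (k : nat) (G : 'M[R]_d) (S : 'M[R]_(k, d)) : 'M[R]_d :=
  kermx (G *m S^T).

(* Trace with respect to G of the bilinear map b restricted to the subspace
   with basis the rows of B; it does not depend on the basis, and it is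
   \sum_i b(e_i, e_i) when the rows of B are G-orthonormal. *)
Definition metric_trace (k e : nat) (G : 'M[R]_d) (B : 'M[R]_(k, d))
    (b : 'rV[R]_d -> 'rV[R]_d -> 'rV[R]_e) : 'rV[R]_e :=
  \sum_(i < k) \sum_(j < k)
    invmx (B *m G *m B^T) i j *: b (row i B) (row j B).

End LinearAlgebra.

(* [nabla] is the Levi-Civita connection of g in coordinates: see the lemmas
   [nabla_torsion_free] and [nabla_metric]. *)
Section LeviCivita.
Context {R : realType} {d : nat} (g : 'rV[R]_d -> 'M[R]_d).

Definition pd (i : 'I_d) (f : 'rV[R]_d -> R) (x : 'rV[R]_d) : R :=
  'D_(delta_mx 0 i) f x.

Definition christoffel (x : 'rV[R]_d) (k i j : 'I_d) : R :=
  2^-1 * \sum_(l < d) invmx (g x) k l *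
    (pd i (fun y => g y j l) x + pd j (fun y => g y i l) x
     - pd l (fun y => g y i j) x).

Definition gamma (x u v : 'rV[R]_d) : 'rV[R]_d :=
  \row_k \sum_(i < d) \sum_(j < d) christoffel x k i j * u 0 i * v 0 j.

Definition nabla (X Y : 'rV[R]_d -> 'rV[R]_d) (x : 'rV[R]_d) : 'rV[R]_d :=
  'D_(X x) Y x + gamma x (X x) (Y x).

End LeviCivita.

Section LeviCivitaTheory.
Context {R : realType} {d : nat} {M : manifold R d} (g : riemannian_metric M).

Lemma smooth_differentiable (V W : normedModType R) (U : set V) (f : V -> W)
  (x : V) : smooth U f -> U x -> differentiable f x.
Proof. by move=> /(_ 1%N)[+ _]; apply. Qed.

Lemma gram_unit a x : cod a x -> g a x \in unitmx.
Proof.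
move=> ax; rewrite -row_free_unit -kermx_eq0; apply/eqP/row_matrixP => i.
rewrite row0; apply/eqP; apply: contraT => u0.
have := gram_pos g ax u0.
by rewrite -row_mul mulmx_ker row0 mul0mx mxE ltxx.
Qed.

Lemma derivable_entry (V : normedModType R) m n (f : V -> 'M[R]_(m, n)) x v i j :
  differentiable f x -> derivable (fun y => f y i j) x v.
Proof. by move=> /diff_derivable/derivable_mxP; apply. Qed.

Lemma differentiable_entry m n (f : 'rV[R]_d -> 'M[R]_(m, n)) x i j :
  differentiable f x -> differentiable (fun y => f y i j) x.
Proof.
move=> df; apply: (@differentiable_comp _ _ _ _ f (fun N => N i j)) => //.
exact: differentiable_coord.
Qed.

Lemma derive_pd (f : 'rV[R]_d -> R) x v : differentiable f x ->
  'D_v f x = \sum_(k < d) v 0 k * pd k f x.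
Proof.
move=> df; rewrite deriveE// {1}(row_sum_delta v) linear_sum.
by apply: eq_bigr => k _; rewrite linearZ /pd -deriveE.
Qed.

Lemma pd_gramC a x i j k : cod a x ->
  pd k (fun y => g a y i j) x = pd k (fun y => g a y j i) x.
Proof.
move=> ax; apply: near_eq_derive.
have : nbhs x (cod a) by apply: open_nbhs_nbhs; split=> //; exact: cod_open.
by apply: filterS => y ay; rewrite -[in RHS](gram_sym g ay) mxE.
Qed.

Lemma christoffelC a x k i j : cod a x ->
  christoffel (g a) x k i j = christoffel (g a) x k j i.
Proof.
move=> ax; rewrite /christoffel; congr (_ * _); apply: eq_bigr => l _.
by rewrite (pd_gramC i j l ax) [X in _ * (X - _)]addrC.
Qed.

Lemma christoffel_gram a x i j k : cod a x ->
  \sum_l christoffel (g a) x l k i * g a x l j =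
  2^-1 * (pd k (fun y => g a y i j) x + pd i (fun y => g a y k j) x
          - pd j (fun y => g a y k i) x).
Proof.
move=> ax; set D := fun l => pd k (fun y => g a y i l) x
  + pd i (fun y => g a y k l) x - pd l (fun y => g a y k i) x.
rewrite -[RHS]/(2^-1 * D j).
under eq_bigr => l _ do rewrite /christoffel -mulrA mulr_suml.
rewrite -mulr_sumr exchange_big /=; congr (_ * _).
have E l : \sum_m invmx (g a x) m l * g a x m j = (l == j)%:R.
  have := mulmxV (gram_unit ax).
  move=> /(congr1 trmx); rewrite trmx_mul (gram_sym g ax) trmx1.
  move=> /matrixP/(_ l j); rewrite !mxE => <-.
  by apply: eq_bigr => m _; rewrite mxE.
transitivity (\sum_l (l == j)%:R * D l).
  apply: eq_bigr => l _; rewrite -E mulr_suml; apply: eq_bigr => m _.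
  by rewrite /D mulrAC (pd_gramC i l k ax) (pd_gramC k l i ax) -(pd_gramC i l k ax).
rewrite (bigD1 j)//= eqxx mul1r big1 ?addr0// => l /negbTE ->.
by rewrite mul0r.
Qed.

Lemma nabla_torsion_free a (X Y : 'rV[R]_d -> 'rV[R]_d) x : cod a x ->
  nabla (g a) X Y x - nabla (g a) Y X x = 'D_(X x) Y x - 'D_(Y x) X x.
Proof.
move=> ax; rewrite /nabla.
have -> : gamma (g a) x (Y x) (X x) = gamma (g a) x (X x) (Y x).
  apply/rowP => k; rewrite !mxE exchange_big /=.
  apply: eq_bigr => i _; apply: eq_bigr => j _.
  by rewrite christoffelC// mulrAC.
by rewrite opprD addrACA subrr addr0.
Qed.

Lemma innerE (G : 'M[R]_d) u v :
  inner G u v = \sum_i \sum_j u 0 i * G i j * v 0 j.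
Proof.
rewrite /inner mxE exchange_big /=; apply: eq_bigr => j _.
by rewrite !mxE mulr_suml.
Qed.

Lemma innerDl (G : 'M[R]_d) u v w : inner G (u + v) w = inner G u w + inner G v w.
Proof. by rewrite /inner !mulmxDl mxE. Qed.

Lemma innerDr (G : 'M[R]_d) u v w : inner G w (u + v) = inner G w u + inner G w v.
Proof. by rewrite /inner linearD mulmxDr mxE. Qed.

Lemma innerC a x u v : cod a x -> inner (g a x) u v = inner (g a x) v u.
Proof.
move=> ax; rewrite !innerE exchange_big /=; apply: eq_bigr => i _.
apply: eq_bigr => j _; rewrite -[in LHS](gram_sym g ax) mxE.
by rewrite mulrC mulrA mulrAC.
Qed.

Lemma inner_gamma a x u v w : cod a x ->
  inner (g a x) (gamma (g a) x u v) w =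
  \sum_k \sum_i \sum_j u 0 k * v 0 i * w 0 j *
   (2^-1 * (pd k (fun y => g a y i j) x + pd i (fun y => g a y k j) x
          - pd j (fun y => g a y k i) x)).
Proof.
move=> ax; rewrite innerE.
under eq_bigr => l _ do under eq_bigr => j _ do rewrite mxE !mulr_suml.
under eq_bigr => l _ do rewrite exchange_big /=.
rewrite exchange_big /=; apply: eq_bigr => k _.
under eq_bigr => l _ do under eq_bigr => j _ do rewrite !mulr_suml.
under eq_bigr => l _ do rewrite exchange_big /=.
rewrite exchange_big /=; apply: eq_bigr => i _.
rewrite exchange_big /=; apply: eq_bigr => j _.
rewrite -christoffel_gram// mulr_sumr; apply: eq_bigr => l _.
by ring.
Qed.

Lemma nabla_metric a (X Y Z : 'rV[R]_d -> 'rV[R]_d) x : cod a x ->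
  smooth (cod a) Y -> smooth (cod a) Z ->
  'D_(X x) (fun y => inner (g a y) (Y y) (Z y)) x =
  inner (g a x) (nabla (g a) X Y x) (Z x) +
  inner (g a x) (Y x) (nabla (g a) X Z x).
Proof.
move=> ax sY sZ; set v := X x.
have dY := smooth_differentiable sY ax.
have dZ := smooth_differentiable sZ ax.
have dG := smooth_differentiable (gram_smooth g a) ax.
pose h i j := (fun y => Y y 0 i) * (fun y => g a y i j) * (fun y => Z y 0 j).
have dh i j : derivable (h i j) x v.
  by apply: derivableM; [apply: derivableM|]; exact: derivable_entry.
have -> : (fun y => inner (g a y) (Y y) (Z y)) = \sum_i \sum_j h i j.
  apply/funext => y; rewrite innerE fct_sumE; apply: eq_bigr => i _.
  by rewrite fct_sumE.
rewrite derive_sum; last by move=> i; exact: derivable_sum.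
under eq_bigr => i _ do rewrite derive_sum//.
rewrite /nabla innerDl innerDr.
rewrite [inner _ (Y x) (gamma _ _ _ _)]innerC// !inner_gamma// -/v.
rewrite addrACA.
set S1 := inner _ ('D_v Y x) _; set S2 := inner _ _ ('D_v Z x).
set S3 := (X in _ = _ + X).
have -> : S3 = \sum_i \sum_j \sum_k
    Y x 0 i * Z x 0 j * (v 0 k * pd k (fun y => g a y i j) x).
  rewrite /S3 [X in _ + X](eq_bigr _ (fun k _ => exchange_big _ _ _ _ _ _)) /=.
  rewrite -big_split/=.
  under [RHS]eq_bigr => i _ do rewrite exchange_big /=.
  rewrite [RHS]exchange_big /=; apply: eq_bigr => k _; rewrite -big_split/=.
  apply: eq_bigr => i _; rewrite -big_split/=; apply: eq_bigr => j _.
  by rewrite (pd_gramC j i k ax); field.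
have dhE i j : 'D_v (h i j) x =
    'D_v (fun y => Y y 0 i) x * g a x i j * Z x 0 j +
    Y x 0 i * g a x i j * 'D_v (fun y => Z y 0 j) x +
    Y x 0 i * Z x 0 j * 'D_v (fun y => g a y i j) x.
  have e1 : derivable (fun y => Y y 0 i) x v by exact: derivable_entry.
  have e2 : derivable (fun y => g a y i j) x v by exact: derivable_entry.
  have e3 : derivable (fun y => Z y 0 j) x v by exact: derivable_entry.
  rewrite (deriveM (derivableM e1 e2) e3) (deriveM e1 e2).
  set A := 'D_v (fun y => Z y 0 j) x; set B := 'D_v (fun y => g a y i j) x.
  set C := 'D_v (fun y => Y y 0 i) x.
  change (Y x 0 i * g a x i j * A +
          Z x 0 j * (Y x 0 i * B + g a x i j * C) =
          C * g a x i j * Z x 0 j + Y x 0 i * g a x i j * A +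
          Y x 0 i * Z x 0 j * B).
  by ring.
under eq_bigr => i _ do under eq_bigr => j _ do rewrite dhE.
rewrite /S1 /S2 !innerE (derive_mx (diff_derivable (v := v) dY)).
rewrite (derive_mx (diff_derivable (v := v) dZ)).
rewrite -big_split -big_split; apply: eq_bigr => i _.
rewrite -big_split -big_split; apply: eq_bigr => j _.
rewrite -mulr_sumr -derive_pd; last exact: differentiable_entry.
by rewrite !mxE.
Qed.

End LeviCivitaTheory.

Section Kahler.
Context {R : realType} {d : nat} {M : manifold R d}.

Record kahler (g : riemannian_metric M) (J : tensor11 M) : Prop := Kahler {
  kahler_square : forall a x, cod a x -> J a x *m J a x = - 1%:M;
  kahler_isometry : forall a x (u v : 'rV[R]_d), cod a x ->
    inner (g a x) (u *m J a x) (v *m J a x) = inner (g a x) u v;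
  kahler_parallel : forall a (X Y : 'rV[R]_d -> 'rV[R]_d),
    smooth (cod a) X -> smooth (cod a) Y -> forall x, cod a x ->
    nabla (g a) X (fun y => Y y *m J a y) x - nabla (g a) X Y x *m J a x = 0
}.

End Kahler.

(* Calculus for a map f between open sets of coordinate spaces endowed with
   metrics g and h. *)
Section LocalMaps.
Context {R : realType} {d e : nat}.
Variables (g : 'rV[R]_d -> 'M[R]_d) (h : 'rV[R]_e -> 'M[R]_e).
Variable f : 'rV[R]_d -> 'rV[R]_e.

Definition push (X : 'rV[R]_d -> 'rV[R]_d) (x : 'rV[R]_d) : 'rV[R]_e :=
  X x *m 'J f x.

(* The pullback of the Levi-Civita connection of h, acting on a section V
   of the pullback by f of the tangent bundle of the target. *)
Definition pullback_nabla (X : 'rV[R]_d -> 'rV[R]_d)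
    (V : 'rV[R]_d -> 'rV[R]_e) (x : 'rV[R]_d) : 'rV[R]_e :=
  'D_(X x) V x + gamma h (f x) (push X x) (V x).

Definition nabla_push (X Y : 'rV[R]_d -> 'rV[R]_d) (x : 'rV[R]_d)
    : 'rV[R]_e :=
  pullback_nabla X (push Y) x - push (nabla g X Y) x.

(* nabla_push is tensorial, so it is evaluated on tangent vectors by extending
   them to vector fields with constant coordinates. *)
Definition tension (x : 'rV[R]_d) : 'rV[R]_e :=
  metric_trace (g x) 1%:M (fun u v => nabla_push (cst u) (cst v) x).

Definition vert (x : 'rV[R]_d) : 'M[R]_d := kermx ('J f x).

Definition hor (x : 'rV[R]_d) : 'M[R]_d := perp (g x) (vert x).

Definition vert_part (X : 'rV[R]_d -> 'rV[R]_d) (x : 'rV[R]_d) : 'rV[R]_d :=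
  X x *m proj_mx (vert x) (hor x).

Definition hor_part (X : 'rV[R]_d -> 'rV[R]_d) (x : 'rV[R]_d) : 'rV[R]_d :=
  X x *m proj_mx (hor x) (vert x).

(* Second fundamental form of the fibre of f through x: the normal part of
   nabla_U V, for any vertical fields U and V extending u and v. *)
Definition fibre_sff (x u v : 'rV[R]_d) : 'rV[R]_d :=
  hor_part (nabla g (vert_part (cst u)) (vert_part (cst v))) x.

Definition mean_curvature (x : 'rV[R]_d) : 'rV[R]_d :=
  (\rank (vert x))%:R^-1 *:
    metric_trace (g x) (row_base (vert x)) (fibre_sff x).

End LocalMaps.

Section Maps.
Context {R : realType} {d e : nat} {M : manifold R d} {N : manifold R e}.
Variable F : M -> N.

Definition loc_dom (a : atlas M) (b : atlas N) : set 'rV[R]_d :=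
  [set x | cod a x /\ dom b (F (psi a x))].

Definition loc (a : atlas M) (b : atlas N) (x : 'rV[R]_d) : 'rV[R]_e :=
  phi b (F (psi a x)).

Definition smooth_map : Prop :=
  continuous F /\ forall a b, smooth (loc_dom a b) (loc a b).

Definition submersion : Prop :=
  smooth_map /\
  forall a b x, loc_dom a b x -> row_full ('J (loc a b) x).

Variables (gM : riemannian_metric M) (gN : riemannian_metric N).

Definition horizontally_conformal (lambda : M -> R) : Prop :=
  (forall p, 0 < lambda p) /\
  forall a b x, loc_dom a b x ->
  forall X Y : 'rV[R]_d,
    (X <= hor (gM a) (loc a b) x)%MS -> (Y <= hor (gM a) (loc a b) x)%MS ->
    lambda (psi a x) ^+ 2 * inner (gM a x) X Y =
    inner (gN b (loc a b x)) (X *m 'J (loc a b) x) (Y *m 'J (loc a b) x).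

Definition harmonic_map : Prop :=
  forall a b x, loc_dom a b x -> tension (gM a) (gN b) (loc a b) x = 0.

Definition minimal_fibres : Prop :=
  forall a b x, loc_dom a b x -> mean_curvature (gM a) (loc a b) x = 0.

Definition semi_invariant (m n r : nat) (J : tensor11 M)
    (D1 : distribution M (2 * m)) : Prop :=
  forall a b x, loc_dom a b x ->
  let V := vert (loc a b) x in
  let H := hor (gM a) (loc a b) x in
  let D2 := (V :&: perp (gM a x) (D1 a x))%MS in
  let mu := (H :&: perp (gM a x) (D2 *m J a x))%MS in
  [/\ (D1 a x <= V)%MS,
      (V :=: D1 a x + D2)%MS /\ mxdirect (D1 a x + D2),
      (D1 a x *m J a x :=: D1 a x)%MS,
      (D2 *m J a x <= H)%MS &
      \rank D2 = n /\ \rank mu = (2 * r)%N].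

Definition conformal_semi_invariant_submersion (m n r : nat)
    (J : tensor11 M) : Prop :=
  [/\ submersion,
      exists lambda : M -> R, horizontally_conformal lambda &
      exists D1 : distribution M (2 * m), semi_invariant n r J D1].

End Maps.

(* Main.v *)
From HB Require Import structures.
Require Import Defs.
From mathcomp Require Import all_boot all_order all_algebra.
From mathcomp Require Import all_classical all_reals all_analysis.
From mathcomp Require Import perm ring lra.
Set Implicit Arguments.
Unset Strict Implicit.
Unset Printing Implicit Defensive.
Import Order.TTheory GRing.Theory Num.Theory.
Import numFieldNormedType.Exports.

(** The argument is pointwise, in charts, and applies to horizontally conformal
    submersions.  Let A be the differential of F and b = nabla(A) its second
    fundamental form.  The trace of b splits into a vertical and a horizontal
    part.  Differentiating V A = 0 along the fibre, for a vertical field V,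
    gives b(U, V) = - (nabla_U V) A, so the vertical part is, up to a nonzero
    factor, the image by A of the mean curvature, which is horizontal.

    For the horizontal part, the gradients B_i of the components of F satisfy
    B A = c H^-1 with c = lambda^2 and H the metric of N.  Differentiating this
    along Z, both Levi-Civita connections being metric, gives
      b(Z, B_j)_k + b(Z, B_k)_j = Z(c) (H^-1)_jk.
    As b is symmetric (here Schwarz's theorem enters), it is determined on
    horizontal vectors by these relations, exactly as in Koszul's formula, and
    its horizontal trace is a multiple of (2 - dim N) grad c, which vanishes
    when dim N = 2. *)

(** * Differential calculus of matrix-valued maps *)

Section MatrixCalculus.
Local Open Scope classical_set_scope.
Local Open Scope ring_scope.
Context {R : realType} {V : normedModType R}.

Lemma differentiable_bigsum (I : Type) (r : seq I) (f : I -> V -> R) x :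
  (forall i, differentiable (f i) x) ->
  differentiable (fun y => \sum_(i <- r) f i y) x.
Proof.
move=> df; elim: r => [|i r IH].
  rewrite (_ : (fun _ => _) = cst 0); first exact: differentiable_cst.
  by apply/funext => y; rewrite big_nil.
rewrite (_ : (fun _ => _) = f i + (fun y => \sum_(i <- r) f i y)).
  exact: differentiableD.
by apply/funext => y; rewrite big_cons.
Qed.

Lemma differentiable_bigprod (I : Type) (r : seq I) (f : I -> V -> R) x :
  (forall i, differentiable (f i) x) ->
  differentiable (fun y => \prod_(i <- r) f i y) x.
Proof.
move=> df; elim: r => [|i r IH].
  rewrite (_ : (fun _ => _) = cst 1); first exact: differentiable_cst.
  by apply/funext => y; rewrite big_nil.
rewrite (_ : (fun _ => _) = f i * (fun y => \prod_(i <- r) f i y)).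
  exact: differentiableM.
by apply/funext => y; rewrite big_cons.
Qed.

Lemma differentiable_coef m n (f : V -> 'M[R]_(m, n)) x i j :
  differentiable f x -> differentiable (fun y => f y i j) x.
Proof.
move=> df; apply: (@differentiable_comp _ _ _ _ f (fun N => N i j)) => //.
exact: differentiable_coord.
Qed.

Lemma differentiable_mx m n (f : V -> 'M[R]_(m, n)) x :
  (forall i j, differentiable (fun y => f y i j) x) -> differentiable f x.
Proof.
move=> df.
have -> : f = \sum_(i < m) \sum_(j < n) (fun y => f y i j *: delta_mx i j).
  apply/funext => y; rewrite fct_sumE {1}(matrix_sum_delta (f y)).
  by apply: eq_bigr => i _; rewrite fct_sumE.
apply: differentiable_sum => i; apply: differentiable_sum => j.
exact: differentiableZl.
Qed.

Lemma differentiable_mulmx m n p (f : V -> 'M[R]_(m, n))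
    (g : V -> 'M[R]_(n, p)) x :
  differentiable f x -> differentiable g x ->
  differentiable (fun y => f y *m g y) x.
Proof.
move=> df dg; apply: differentiable_mx => i j.
under eq_fun do rewrite mxE.
apply: differentiable_bigsum => k.
by apply: differentiableM; apply: differentiable_coef.
Qed.

Lemma differentiable_trmx m n (f : V -> 'M[R]_(m, n)) x :
  differentiable f x -> differentiable (fun y => (f y)^T) x.
Proof.
move=> df; apply: differentiable_mx => i j.
by under eq_fun do rewrite mxE; exact: differentiable_coef.
Qed.

Lemma differentiable_det n (f : V -> 'M[R]_n) x :
  differentiable f x -> differentiable (fun y => \det (f y)) x.
Proof.
move=> df; apply: differentiable_bigsum => s.
have dp : differentiable (fun y => \prod_i f y i (s i)) x.
  by apply: differentiable_bigprod => i; exact: differentiable_coef.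
exact: (differentiableM (differentiable_cst ((-1) ^+ s : R) x) dp).
Qed.

(** The differential of [f] at [x] also serves for [g], the first-order expansions being the same.
    It allows the use of formulas valid only near the point. *)
Lemma near_eq_differentiable (W : normedModType R) (f g : V -> W) x :
  (\near x, f x = g x) -> differentiable f x -> differentiable g x.
Proof.
move=> fg df; have [cdf /eqaddoP of_] := (diff_locallyP _ _).1 df.
have E : g \o shift x = cst (g x) + 'd f x +o_ 0 id.
  apply/eqaddoP => e e0; have := of_ e e0.
  have fgx : f x = g x by exact: (nbhs_singleton fg).
  have : \forall z \near (0 : V), f (z + x) = g (z + x).
    move: fg; rewrite (near_shift 0 x).
    by apply: filterS => y /=; rewrite subr0.
  by apply: filterS2 => y yfg; rewrite !fctE /= yfg fgx.
by apply/diff_locallyP; rewrite (diff_unique cdf E).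
Qed.

(** Cramer's rule: the determinant stays nonzero near [x], so there [invmx] is the adjugate divided
    by the determinant. *)
Lemma differentiable_invmx n (f : V -> 'M[R]_n) x :
  f x \in unitmx -> differentiable f x ->
  differentiable (fun y => invmx (f y)) x.
Proof.
move=> fu df; have dd := differentiable_det df.
have d0 : \det (f x) != 0 by move: fu; rewrite unitmxE unitfE.
have near_unit : \near x, f x \in unitmx.
  have /(_ _ d0) := cvgr_neq0 _ (differentiable_continuous dd).
  by apply: filterS => y; rewrite unitmxE unitfE.
apply: (@near_eq_differentiable _ (fun y => (\det (f y))^-1 *: \adj (f y))).
  by apply: filterS near_unit => y fy; rewrite /invmx fy.
apply: differentiable_mx => i j; under eq_fun do rewrite mxE.
apply: (differentiableM (differentiableV dd d0)).
under eq_fun do rewrite mxE.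
apply: (differentiableM (differentiable_cst ((-1) ^+ (j + i) : R) x)).
apply: differentiable_det; apply: differentiable_mx => k l.
by under eq_fun do rewrite !mxE; exact: differentiable_coef.
Qed.

Lemma derive_coef m n (f : V -> 'M[R]_(m, n)) x v i j :
  differentiable f x -> ('D_v f x) i j = 'D_v (fun y => f y i j) x.
Proof. by move=> df; rewrite derive_mx ?mxE//; exact: diff_derivable. Qed.

Lemma derive_mulmx m n p (f : V -> 'M[R]_(m, n)) (g : V -> 'M[R]_(n, p)) x v :
  differentiable f x -> differentiable g x ->
  'D_v (fun y => f y *m g y) x = 'D_v f x *m g x + f x *m 'D_v g x.
Proof.
move=> df dg; apply/matrixP => i j.
rewrite derive_coef; last exact: differentiable_mulmx.
rewrite !mxE.
have -> : (fun y => (f y *m g y) i j) =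
    \sum_(k < n) ((fun y => f y i k) * (fun y => g y k j)).
  by apply/funext => y; rewrite mxE fct_sumE.
have df' k : derivable (fun y => f y i k) x v by exact: derivable_entry.
have dg' k : derivable (fun y => g y k j) x v by exact: derivable_entry.
rewrite derive_sum; last by move=> k; exact: derivableM.
rewrite -big_split; apply: eq_bigr => k _ /=.
by rewrite deriveM// !derive_coef// [LHS]addrC; congr (_ + _); exact: mulrC.
Qed.

Lemma derive_trmx m n (f : V -> 'M[R]_(m, n)) x v :
  differentiable f x -> 'D_v (fun y => (f y)^T) x = ('D_v f x)^T.
Proof.
move=> df; apply/matrixP => i j; rewrite derive_coef; last first.
  exact: differentiable_trmx.
by rewrite mxE derive_coef//; under eq_fun do rewrite mxE.
Qed.

Lemma derive_scalemx m n (c : V -> R) (f : V -> 'M[R]_(m, n)) x v :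
  differentiable c x -> differentiable f x ->
  'D_v (fun y => c y *: f y) x = 'D_v c x *: f x + c x *: 'D_v f x.
Proof.
move=> dc df; apply/matrixP => i j; rewrite derive_coef; last first.
  apply: differentiable_mx => k l; under eq_fun do rewrite mxE.
  by apply: (differentiableM dc); exact: differentiable_coef.
under eq_fun do rewrite mxE; rewrite !mxE derive_coef//.
rewrite (@deriveM _ _ c (fun y => f y i j)); last 2 first.
- exact: diff_derivable.
- exact: derivable_entry.
by rewrite [LHS]addrC; congr (_ + _); exact: mulrC.
Qed.

(** Obtained by differentiating [f y *m invmx (f y) = 1%:M], an identity on a neighbourhood of
    [x]. *)
Lemma derive_invmx n (f : V -> 'M[R]_n) x v :
  (\near x, f x \in unitmx) -> differentiable f x ->
  'D_v (fun y => invmx (f y)) x = - (invmx (f x) *m 'D_v f x *m invmx (f x)).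
Proof.
move=> fu df; have fxu := nbhs_singleton fu.
have di := differentiable_invmx fxu df.
have : 'D_v (fun y => f y *m invmx (f y)) x = 0.
  rewrite (near_eq_derive _ (g := cst 1%:M)) ?derive_cst//.
  by apply: filterS fu => y fyu; rewrite mulmxV.
rewrite derive_mulmx// => /addr0_eq fD.
rewrite -(mulKmx fxu ('D_v (fun y => invmx (f y)) x)) -fD.
by rewrite mulmxN mulmxA.
Qed.

Lemma derive_comp (W W' : normedModType R) (f : V -> W) (g : W -> W') x v :
  differentiable f x -> differentiable g (f x) ->
  'D_v (fun y => g (f y)) x = 'D_('D_v f x) g (f x).
Proof.
move=> df dg; rewrite !deriveE//; last exact: differentiable_comp.
by rewrite (diff_comp df dg).
Qed.

End MatrixCalculus.

(** * Symmetry of second derivatives *)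

Section Schwarz.
Local Open Scope classical_set_scope.
Local Open Scope ring_scope.
Context {R : realType} {V : normedModType R}.

Lemma is_derive_line (f : V -> R) (x v : V) (t : R) :
  differentiable f (x + t *: v) ->
  is_derive t 1 (fun s : R => f (x + s *: v)) ('D_v f (x + t *: v)).
Proof.
move=> df; have dl : is_diff t (fun s : R => x + s *: v) ( *:%R^~ v).
  by apply: is_diff_eq; rewrite add0r.
have dc : differentiable (fun s : R => f (x + s *: v)) t.
  exact: (@differentiable_comp _ _ _ _ (fun s : R => x + s *: v) f).
apply: DeriveDef; first exact: diff_derivable.
rewrite deriveE// (@diff_comp _ _ _ _ (fun s : R => x + s *: v) f)//=.
by rewrite diff_val scale1r deriveE.
Qed.

(* The mean value theorem in the direction u reduces the second difference to
   the increment of 'D_u f, so differentiability of 'D_u f at x suffices. *)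
Lemma second_difference (f : V -> R) (x u v : V) (e : R) : 0 < e ->
  (\near x, differentiable f x) -> differentiable ('D_u f) x ->
  \forall t \near (0 : R)^'+,
    `|(f (x + t *: u + t *: v) - f (x + t *: u) - (f (x + t *: v) - f x))
      - t ^+ 2 * 'D_v ('D_u f) x| <= e * t ^+ 2.
Proof.
move=> e0 df ddf; set D : {linear V -> R} := 'd ('D_u f) x.
(* The two expansion errors below add up to at most [e / C * (t * (C - 1))]; the extra 1 makes [C]
   positive. *)
set C := 2 * `|u| + `|v| + 1; have C0 : 0 < C.
  by rewrite ltr_wpDl// addr_ge0// mulr_ge0.
have eC0 : 0 < e / C by rewrite divr_gt0.
have /eqaddoP/(_ _ eC0) := diff_locally ddf.
move=> /nbhs_ballP[r1 /= r10 hr1].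
move: df => /nbhs_ballP[r2 /= r20 hr2].
near=> t.
have t0 : 0 < t by near: t; exact: nbhs_right_gt.
have tC1 : t * C < r1.
  by rewrite -ltr_pdivlMr//; near: t; apply: nbhs_right_lt; rewrite divr_gt0.
have tC2 : t * C < r2.
  by rewrite -ltr_pdivlMr//; near: t; apply: nbhs_right_lt; rewrite divr_gt0.
have small (w : V) : `|w| <= t * (`|u| + `|v|) -> `|w| < r1 /\ `|w| < r2.
  move=> hw; have : t * (`|u| + `|v|) < t * C.
    rewrite ltr_pM2l// /C; have := normr_ge0 u; lra.
  by move=> h; split; apply: le_lt_trans hw (lt_trans h _).
have fd w : `|w| <= t * (`|u| + `|v|) -> differentiable f (x + w).
  move=> /small[_ h]; apply: hr2.
  by rewrite -ball_normE /= opprD addNKr normrN.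
have fu w : `|w| <= t * (`|u| + `|v|) ->
    `|'D_u f (x + w) - 'D_u f x - D w| <= e / C * `|w|.
  move=> /small[h _]; have := hr1 w; rewrite -ball_normE /= sub0r normrN.
  by move=> /(_ h); rewrite !fctE /= [w + x]addrC opprD addrA.
have n1 (s : R) : 0 <= s -> s <= t -> `|s *: u| <= t * `|u|.
  by move=> s0 st; rewrite normrZ ger0_norm// ler_wpM2r.
have n2 (s : R) : 0 <= s -> s <= t ->
    `|t *: v + s *: u| <= t * (`|u| + `|v|).
  move=> s0 st; rewrite (le_trans (ler_normD _ _))// mulrDr addrC lerD ?n1//.
  by rewrite normrZ gtr0_norm.
have n3 (s : R) : 0 <= s -> s <= t -> `|s *: u| <= t * (`|u| + `|v|).
  move=> s0 st; apply: le_trans (n1 _ s0 st) _.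
  by rewrite ler_wpM2l ?(ltW t0)// lerDl.
(* The increment of [g] from 0 to [t] is the second difference. *)
pose g (s : R) := f (x + t *: v + s *: u) - f (x + s *: u).
have dg (s : R) : 0 <= s -> s <= t -> is_derive s 1 g
    ('D_u f (x + t *: v + s *: u) - 'D_u f (x + s *: u)).
  move=> s0 st; apply: is_deriveB; apply: is_derive_line.
    by rewrite -addrA; apply: fd; exact: n2.
  by apply: fd; exact: n3.
have dg' (s : R) : s \in `]0, t[ -> is_derive s 1 g
    ('D_u f (x + t *: v + s *: u) - 'D_u f (x + s *: u)).
  by rewrite in_itv => /andP[s0 st]; apply: dg; exact: ltW.
have cg : {within `[0, t], continuous g}.
  apply: derivable_within_continuous => s; rewrite in_itv => /andP[s0 st].
  by have := dg s s0 st => hs; exact: ex_derive.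
have [c] := MVT t0 dg' cg.
rewrite in_itv /= => /andP[c0 ct]; rewrite subr0 /g scale0r !addr0.
rewrite [x + t *: u + _]addrAC => gE.
have -> : f (x + t *: v + t *: u) - f (x + t *: u) - (f (x + t *: v) - f x) =
  ('D_u f (x + (t *: v + c *: u)) - 'D_u f (x + c *: u)) * t.
  by rewrite addrA -gE.
have := fu _ (n2 _ (ltW c0) (ltW ct)); have := fu _ (n3 _ (ltW c0) (ltW ct)).
have -> : D (t *: v + c *: u) = t * 'D_v ('D_u f) x + D (c *: u).
  by rewrite linearD linearZ /= deriveE.
set a := 'D_u f (x + c *: u); set b := 'D_u f (x + (t *: v + c *: u)).
have := n2 _ (ltW c0) (ltW ct); have := n1 _ (ltW c0) (ltW ct).
set m1 := `|c *: u|; set m2 := `|t *: v + c *: u| => hm1 hm2 h1 h2.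
have {}h1 := le_trans h1 (ler_wpM2l (ltW eC0) hm1).
have {}h2 := le_trans h2 (ler_wpM2l (ltW eC0) hm2).
set L := 'D_v _ x in h2 *.
(* Difference of the first-order expansions of ['D_u f] at the two points: by linearity of [D] the
   terms in [c *: u] cancel and [t * L] remains. *)
have -> : (b - a) * t - t ^+ 2 * L =
   t * ((b - 'D_u f x - (t * L + D (c *: u))) - (a - 'D_u f x - D (c *: u))).
  by ring.
rewrite normrM gtr0_norm// expr2 mulrCA ler_pM2l//.
apply: le_trans (ler_normB _ _) _; apply: le_trans (lerD h2 h1) _.
rewrite -!mulrDr.
have -> : e / C * (t * (`|u| + `|v| + `|u|)) = e * t * ((C - 1) / C).
  by have := C0; rewrite /C => C0'; field; apply: lt0r_neq0; move: C0'; lra.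
rewrite -[leRHS]mulr1 ler_wpM2l ?mulr_ge0 ?(ltW e0) ?(ltW t0)//.
by rewrite ler_pdivrMr// mul1r gerBl.
Unshelve. all: by end_near. Qed.

(** The second difference is symmetric in [u] and [v]; divided by [t ^+ 2] it approximates both
    mixed derivatives, which therefore differ by at most any [e > 0]. *)
Lemma derive_derive (f : V -> R) (x u v : V) :
  (\near x, differentiable f x) ->
  differentiable ('D_u f) x -> differentiable ('D_v f) x ->
  'D_u ('D_v f) x = 'D_v ('D_u f) x.
Proof.
move=> df du dv; apply/eqP; rewrite -subr_eq0 -normr_le0.
apply/ler_addgt0Pr => e e0; rewrite add0r.
have e20 : 0 < e / 2 by rewrite divr_gt0.
have h1 := second_difference v e20 df du.
have h2 := second_difference u e20 df dv.
have [t [t0 ht1 ht2]] : exists t : R, [/\ 0 < t,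
    `|(f (x + t *: u + t *: v) - f (x + t *: u) - (f (x + t *: v) - f x))
      - t ^+ 2 * 'D_v ('D_u f) x| <= e / 2 * t ^+ 2 &
    `|(f (x + t *: v + t *: u) - f (x + t *: v) - (f (x + t *: u) - f x))
      - t ^+ 2 * 'D_u ('D_v f) x| <= e / 2 * t ^+ 2].
  have [t [[ht1 ht2] t0]] :=
    filter_ex (filterI (filterI h1 h2) (nbhs_right_gt (0 : R))).
  by exists t; split; [exact: t0|exact: ht1|exact: ht2].
have t2 : 0 < t ^+ 2 by rewrite exprn_gt0.
rewrite -(ler_pM2r t2) -[X in _ * X <= _](gtr0_norm t2) -normrM.
move: ht1 ht2; rewrite (addrAC x (t *: v)) => ht1 ht2.
set X := f (x + t *: u + t *: v) - f (x + t *: u) - (f (x + t *: v) - f x)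
  in ht1.
have XE : f (x + t *: u + t *: v) - f (x + t *: v) - (f (x + t *: u) - f x) = X.
  by rewrite /X; ring.
rewrite XE in ht2; set D1 := 'D_v _ x in ht1 *; set D2 := 'D_u _ x in ht2 *.
have -> : (D2 - D1) * t ^+ 2 = (X - t ^+ 2 * D1) - (X - t ^+ 2 * D2) by ring.
apply: le_trans (ler_normB _ _) _.
by apply: le_trans (lerD ht1 ht2) _; rewrite -mulrDl -splitr.
Qed.

End Schwarz.

(** * Vertical and horizontal subspaces of a tangent space *)

Section SplittingOfATangentSpace.
Local Open Scope ring_scope.
Context {R : realType} {d e : nat}.
Variables (G : 'M[R]_d) (A : 'M[R]_(d, e)).
Hypothesis G_sym : G^T = G.
Hypothesis G_pos : forall u : 'rV[R]_d, u != 0 -> 0 < (u *m G *m u^T) 0 0.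
Hypothesis A_full : row_full A.

(** If [u] is in the kernel of the Gram matrix, then [u *m B] has length zero, hence vanishes, and
    so does [u] because [B] is row free. *)
Lemma gram_rows_unit k (B : 'M[R]_(k, d)) :
  row_free B -> B *m G *m B^T \in unitmx.
Proof.
move=> fB; rewrite -row_free_unit -kermx_eq0; apply/rowV0P => u /sub_kermxP uK.
apply/eqP; rewrite -(mulmx_free_eq0 u fB); apply: contraT => /G_pos.
rewrite trmx_mul -!mulmxA (mulmxA B) (mulmxA _ _ u^T) (mulmxA u) uK.
by rewrite mul0mx mxE ltxx.
Qed.

Lemma gram_unitmx : G \in unitmx.
Proof.
have := @gram_rows_unit _ 1%:M; rewrite trmx1 mul1mx mulmx1; apply.
by rewrite row_free_unit unitmx1.
Qed.

Lemma invmx_gram_sym : (invmx G)^T = invmx G.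
Proof. by rewrite trmx_inv G_sym. Qed.

(* The rows of [grad] are the gradients of the components of a map with
   differential A: they form a basis of the horizontal space. *)
Definition grad : 'M[R]_(e, d) := A^T *m invmx G.

Lemma grad_gram : grad *m G = A^T.
Proof. by rewrite /grad mulmxKV// gram_unitmx. Qed.

Lemma grad_tr : grad^T = invmx G *m A.
Proof. by rewrite trmx_mul trmxK invmx_gram_sym. Qed.

Lemma grad_gram_grad : grad *m G *m grad^T = grad *m A.
Proof. by rewrite grad_gram grad_tr mulmxA. Qed.

Lemma grad_free : row_free grad.
Proof.
rewrite /row_free /grad mxrankMfree ?mxrank_tr//.
by rewrite row_free_unit unitmx_inv gram_unitmx.
Qed.

Lemma grad_mul_unit : grad *m A \in unitmx.
Proof. by rewrite -grad_gram_grad; exact: gram_rows_unit grad_free. Qed.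

Lemma grad_mul_sym : (grad *m A)^T = grad *m A.
Proof. by rewrite trmx_mul grad_tr mulmxA. Qed.

Lemma grad_sub_perp : (grad <= perp G (kermx A))%MS.
Proof.
by apply/sub_kermxP; rewrite mulmxA grad_gram -trmx_mul mulmx_ker trmx0.
Qed.

Lemma kermx_perp0 : (kermx A :&: perp G (kermx A))%MS = 0.
Proof.
apply/eqP/rowV0P => u; rewrite sub_capmx => /andP[uA /sub_kermxP].
move/submxP: uA => [c uE] uG; apply/eqP; apply: contraT => /G_pos.
by rewrite [in X in _ *m X]uE trmx_mul mulmxA -(mulmxA u) uG mul0mx mxE ltxx.
Qed.

(** Orthogonal projection onto the horizontal space, in a closed form that can be differentiated
    with respect to the base point; [proj_hor_mx] identifies it with [proj_mx]. *)
Definition hproj : 'M[R]_d := A *m invmx (grad *m A) *m grad.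

Lemma hproj_mul : hproj *m A = A.
Proof. by rewrite /hproj -mulmxA mulmxKV// grad_mul_unit. Qed.

Lemma hproj_sub : (hproj <= perp G (kermx A))%MS.
Proof. exact: submx_trans (submxMl _ _) grad_sub_perp. Qed.

Lemma compl_hproj_sub : (1%:M - hproj <= kermx A)%MS.
Proof. by apply/sub_kermxP; rewrite mulmxBl mul1mx hproj_mul subrr. Qed.

(** The identity is the sum of [1%:M - hproj], whose rows are vertical, and [hproj], whose rows are
    horizontal. *)
Lemma proj_hor_mx : proj_mx (perp G (kermx A)) (kermx A) = hproj.
Proof.
have I0 := kermx_perp0; rewrite capmxC in I0.
rewrite -[LHS]mul1mx -[X in X *m _](subrK hproj) mulmxDl.
by rewrite (proj_mx_0 I0 compl_hproj_sub) (proj_mx_id I0 hproj_sub) add0r.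
Qed.

Lemma proj_vert_mx : proj_mx (kermx A) (perp G (kermx A)) = 1%:M - hproj.
Proof.
have I0 := kermx_perp0.
rewrite -[LHS]mul1mx -[X in X *m _](subrK hproj) mulmxDl.
by rewrite (proj_mx_id I0 compl_hproj_sub) (proj_mx_0 I0 hproj_sub) addr0.
Qed.

Lemma perp_mul_eq0 (w : 'rV[R]_d) :
  (w <= perp G (kermx A))%MS -> w *m A = 0 -> w = 0.
Proof.
move=> wH /sub_kermxP wV; apply/eqP; rewrite -submx0 -kermx_perp0.
by rewrite sub_capmx wV.
Qed.

(** The vertical projection [1%:M - hproj] equals [G *m V^T *m Q *m V]; multiplying
    [(1%:M - hproj) + hproj] on the left by [invmx G] gives the two terms. *)
Lemma invmx_gram_split (V := row_base (kermx A)) :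
  invmx G = V^T *m invmx (V *m G *m V^T) *m V
            + grad^T *m invmx (grad *m G *m grad^T) *m grad.
Proof.
have Vf : row_free V by exact: row_base_free.
have VE : (V :=: kermx A)%MS by exact: eq_row_base.
clearbody V; set Q := invmx (V *m G *m V^T).
have Vu : V *m G *m V^T \in unitmx by exact: gram_rows_unit.
have gradV : grad *m G *m V^T = 0.
  rewrite grad_gram -trmx_mul; apply/eqP; rewrite trmx_eq0.
  apply/eqP/sub_kermxP.
  by rewrite VE.
rewrite -[LHS]mulmx1 -[X in _ *m X](subrK hproj) mulmxDr.
congr (_ + _); last first.
  by rewrite grad_gram_grad grad_tr /hproj !mulmxA.
have /submxP[c cE] : (1%:M - hproj <= V)%MS.
  by rewrite VE compl_hproj_sub.
(* Right multiplication by [G *m V^T *m Q *m V] fixes the rows of [V] and kills those of [grad]. *)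
have gV : (1%:M - hproj) *m (G *m V^T *m Q *m V) = 1%:M - hproj.
  by rewrite cE -!mulmxA (mulmxA G) (mulmxA V) (mulmxA V) mulKVmx.
have hV : hproj *m (G *m V^T *m Q *m V) = 0.
  have g0 : grad *m (G *m V^T *m Q *m V) = 0 by rewrite !mulmxA gradV !mul0mx.
  by rewrite /hproj -mulmxA g0 mulmx0.
have E : 1%:M - hproj = G *m V^T *m Q *m V.
  by rewrite -gV mulmxBl mul1mx hV subr0.
by rewrite E !mulmxA mulVmx ?mul1mx// gram_unitmx.
Qed.

End SplittingOfATangentSpace.

(** * Traces of bilinear maps with respect to a metric *)

Section MetricTrace.
Local Open Scope ring_scope.
Context {R : realType} {d e : nat}.

Lemma bilinear_expand (b : 'rV[R]_d -> 'rV[R]_d -> 'rV[R]_e) :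
  (forall v, linear (b^~ v)) -> (forall u, linear (b u)) -> forall u v,
  b u v = \sum_k \sum_l (u 0 k * v 0 l) *: b (delta_mx 0 k) (delta_mx 0 l).
Proof.
move=> bl br u v.
have E (f : 'rV[R]_d -> 'rV[R]_e) (w : 'rV[R]_d) : linear f ->
    f w = \sum_k w 0 k *: f (delta_mx 0 k).
  move=> lf; pose fL : {linear 'rV[R]_d -> 'rV[R]_e} :=
    HB.pack f (GRing.isLinear.Build _ _ _ _ _ lf).
  rewrite -[f]/(fL : _ -> _) {1}(row_sum_delta w) linear_sum.
  by apply: eq_bigr => k _; rewrite linearZ.
rewrite (E (b^~ v))//; apply: eq_bigr => k _; rewrite (E (b _))// scaler_sumr.
by apply: eq_bigr => l _; rewrite scalerA.
Qed.

Variable G : 'M[R]_d.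
Variable b : 'rV[R]_d -> 'rV[R]_d -> 'rV[R]_e.
Hypothesis b_linl : forall v, linear (b^~ v).
Hypothesis b_linr : forall u, linear (b u).

(** The basis [B] enters the trace only through the matrix displayed here, so an identity between
    such matrices becomes an identity between traces. *)
Lemma metric_trace_expand k (B : 'M[R]_(k, d)) :
  metric_trace G B b = \sum_p \sum_q
    (B^T *m invmx (B *m G *m B^T) *m B) p q
      *: b (delta_mx 0 p) (delta_mx 0 q).
Proof.
rewrite /metric_trace; set S := invmx _.
under eq_bigr => i _ do under eq_bigr => j _ do
  rewrite (bilinear_expand b_linl b_linr) scaler_sumr.
under eq_bigr => i _ do rewrite exchange_big /=.
rewrite exchange_big /=; apply: eq_bigr => p _.
under eq_bigr => i _ do under eq_bigr => j _ do rewrite scaler_sumr.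
under eq_bigr => i _ do rewrite exchange_big /=.
rewrite exchange_big /=; apply: eq_bigr => q _.
rewrite mxE scaler_suml exchange_big /=; apply: eq_bigr => j _.
rewrite [in RHS]mxE mulr_suml scaler_suml; apply: eq_bigr => i _.
by rewrite scalerA !mxE; congr (_ *: _); ring.
Qed.

(** For [B = 1%:M] the matrix of [metric_trace_expand] is [invmx G], which [invmx_gram_split]
    decomposes. *)
Lemma metric_trace_split (A : 'M[R]_(d, e)) : G^T = G ->
  (forall u : 'rV[R]_d, u != 0 -> 0 < (u *m G *m u^T) 0 0) -> row_full A ->
  metric_trace G 1%:M b =
  metric_trace G (row_base (kermx A)) b + metric_trace G (grad G A) b.
Proof.
move=> Gs Gp Af; rewrite !metric_trace_expand trmx1 mulmx1 !mul1mx mulmx1.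
rewrite {1}(invmx_gram_split Gs Gp Af) -big_split; apply: eq_bigr => p _ /=.
by rewrite -big_split; apply: eq_bigr => q _ /=; rewrite mxE scalerDl.
Qed.

End MetricTrace.

(** * The Levi-Civita connection in matrix form *)

Section ChristoffelMatrix.
Local Open Scope classical_set_scope.
Local Open Scope ring_scope.
Context {R : realType} {d : nat}.

(** The connection form evaluated at [u], acting on row vectors from the right; see [gammaE]. *)
Definition gamma_mx (g : 'rV[R]_d -> 'M[R]_d) (x u : 'rV[R]_d) : 'M[R]_d :=
  \matrix_(j, k) \sum_i christoffel g x k i j * u 0 i.

Lemma gammaE g x u v : gamma g x u v = v *m gamma_mx g x u.
Proof.
apply/rowP => k; rewrite !mxE exchange_big /=; apply: eq_bigr => j _.
by rewrite mxE mulr_sumr; apply: eq_bigr => i _; rewrite mulrC.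
Qed.

Lemma gamma_mx_linear g x : linear (gamma_mx g x).
Proof.
move=> c u v; apply/matrixP => j k; rewrite !mxE mulr_sumr -big_split /=.
by apply: eq_bigr => i _; rewrite !mxE; ring.
Qed.

Context {M : manifold R d} (g : riemannian_metric M).

Lemma gammaC a x u v : cod a x -> gamma (g a) x u v = gamma (g a) x v u.
Proof.
move=> ax; apply/rowP => k; rewrite !mxE exchange_big /=.
apply: eq_bigr => i _; apply: eq_bigr => j _.
by rewrite christoffelC// mulrAC.
Qed.

Lemma smooth_cst (V W : normedModType R) (U : set V) (w : W) :
  smooth U (cst w).
Proof.
move=> k; elim: k w => [|k IH] w /=; first by move=> x _; exact: cvg_cst.
split=> [x _|v]; first exact: differentiable_cst.
rewrite (_ : (fun x => 'D_v (cst w) x) = cst 0); first exact: IH.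
by apply/funext => x; rewrite derive_cst.
Qed.

(** This is [nabla_metric] for coordinate fields, whose covariant derivatives reduce to the
    Christoffel term. *)
Lemma derive_gram a x u : cod a x ->
  'D_u (g a) x = gamma_mx (g a) x u *m g a x + g a x *m (gamma_mx (g a) x u)^T.
Proof.
move=> ax; have dg := smooth_differentiable (gram_smooth g a) ax.
have innerE1 (H : 'M[R]_d) i j :
    inner H (delta_mx 0 i) (delta_mx 0 j) = H i j.
  by rewrite /inner trmx_delta -rowE -colE !mxE.
apply/matrixP => i j; rewrite derive_coef//.
have := @nabla_metric _ _ _ g a (cst u) _ _ x ax
  (smooth_cst _ (delta_mx 0 i)) (smooth_cst _ (delta_mx 0 j)).
rewrite /nabla !derive_cst !add0r !gammaE /=.
rewrite (_ : (fun y => inner _ _ _) = (fun y => g a y i j)); last first.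
  by apply/funext => y; rewrite /= innerE1.
move=> ->; rewrite mxE; congr (_ + _).
  by rewrite -innerE1 /inner -!mulmxA.
by rewrite -innerE1 /inner trmx_mul !mulmxA.
Qed.

End ChristoffelMatrix.

(** * The second fundamental form of a map, in charts *)

Section SecondFundamentalForm.
Local Open Scope classical_set_scope.
Local Open Scope ring_scope.
Context {R : realType} {d e : nat} {M : manifold R d} {N : manifold R e}.
Variables (gM : riemannian_metric M) (gN : riemannian_metric N).
Variables (a : atlas M) (b : atlas N) (f : 'rV[R]_d -> 'rV[R]_e).
Variable U : set 'rV[R]_d.
Hypothesis U_open : open U.
Hypothesis U_cod : forall y, U y -> cod a y.
Hypothesis U_map : forall y, U y -> cod b (f y).
Hypothesis f_smooth : smooth U f.
Variable x : 'rV[R]_d.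
Hypothesis Ux : U x.

Let g := gM a.
Let h := gN b.

(* Encodes the second fundamental form: [nabla_push] at (u, v) is
   [v *m sff_mx u], see [nabla_pushE]. *)
Definition sff_mx (u : 'rV[R]_d) : 'M[R]_(d, e) :=
  'D_u (jacobian f) x + 'J f x *m gamma_mx h (f x) (u *m 'J f x)
  - gamma_mx g x u *m 'J f x.

Lemma nbhs_dom : \forall y \near x, U y.
Proof. by apply: open_nbhs_nbhs; split. Qed.

Lemma differentiable_derive y v : U y -> differentiable ('D_v f) y.
Proof. by move=> Uy; have [_ /(_ v)[+ _]] := f_smooth 2; apply. Qed.

Lemma derive_jacobian y v : U y -> 'D_v f y = v *m 'J f y.
Proof.
by move=> Uy; apply: deriveEjacobian; exact: smooth_differentiable Uy.
Qed.

Lemma differentiable_jacobian : differentiable (jacobian f) x.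
Proof.
apply: differentiable_mx => i j.
apply: (@near_eq_differentiable _ _ _ (fun y => ('D_(delta_mx 0 i) f y) 0 j)).
  by apply: filterS nbhs_dom => y Uy; rewrite derive_jacobian// -rowE mxE.
exact/differentiable_coef/differentiable_derive.
Qed.

(** Both sides are iterated directional derivatives of [f], so [derive_derive] applies to each
    component. *)
Lemma derive_jacobianC u v :
  v *m 'D_u (jacobian f) x = u *m 'D_v (jacobian f) x.
Proof.
have dJ := differentiable_jacobian.
have E w z : z *m 'D_w (jacobian f) x = 'D_w ('D_z f) x.
  rewrite -[LHS]add0r -(mul0mx _ ('J f x)) -(derive_cst z x w).
  rewrite -(derive_mulmx _ (differentiable_cst z x) dJ).
  apply: near_eq_derive; apply: filterS nbhs_dom => y Uy.
  by rewrite derive_jacobian.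
rewrite !E; apply/rowP => j.
have fj w y : U y -> ('D_w f y) 0 j = 'D_w (fun y => f y 0 j) y.
  by move=> Uy; rewrite derive_coef//; exact: smooth_differentiable Uy.
have nfj w : \forall y \near x, ('D_w f y) 0 j = 'D_w (fun z => f z 0 j) y.
  by apply: filterS nbhs_dom => y Uy; exact: fj.
have coef_dd w z : ('D_w ('D_z f) x) 0 j = 'D_w ('D_z (fun y => f y 0 j)) x.
  apply: etrans (near_eq_derive w (nfj z)).
  exact: derive_coef w 0 j (differentiable_derive z Ux).
apply: etrans (coef_dd u v) _; apply: etrans (esym (coef_dd v u)).
apply: derive_derive.
- apply: filterS nbhs_dom => y Uy; apply: differentiable_coef.
  exact: smooth_differentiable Uy.
- apply: near_eq_differentiable (nfj u) _.
  exact/differentiable_coef/differentiable_derive.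
- apply: near_eq_differentiable (nfj v) _.
  exact/differentiable_coef/differentiable_derive.
Qed.

Lemma nabla_pushE u v : nabla_push g h f (cst u) (cst v) x = v *m sff_mx u.
Proof.
rewrite /nabla_push /pullback_nabla /push /nabla derive_cst add0r !gammaE /=.
rewrite (derive_mulmx u (differentiable_cst v x) differentiable_jacobian).
by rewrite derive_cst mul0mx add0r /sff_mx mulmxBr mulmxDr !mulmxA.
Qed.

Lemma sff_mx_linear : linear sff_mx.
Proof.
move=> c u v; rewrite /sff_mx mulmxDl -scalemxAl !gamma_mx_linear.
rewrite !deriveE; try exact: differentiable_jacobian.
rewrite linearP mulmxDr mulmxDl -scalemxAr -scalemxAl.
set X1 := 'd _ x u; set X2 := 'd _ x v; set X3 := _ *m gamma_mx h _ _.
set X4 := _ *m gamma_mx h _ _; set X5 := gamma_mx g x u *m _.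
set X6 := gamma_mx g x v *m _; clearbody X1 X2 X3 X4 X5 X6.
by apply/matrixP => i j; rewrite !mxE; ring.
Qed.

(** The derivative of the Jacobian is symmetric by Schwarz's theorem, the two Christoffel terms
    because both connections are torsion free. *)
Lemma sff_mxC u v : v *m sff_mx u = u *m sff_mx v.
Proof.
rewrite /sff_mx !mulmxBr !mulmxDr !mulmxA -!gammaE derive_jacobianC.
have Eh := gammaC gN (u *m 'J f x) (v *m 'J f x) (U_map Ux).
have Eg := gammaC gM u v (U_cod Ux).
apply: (f_equal2 (fun X Y : 'rV[R]_e => X - Y)); last first.
  exact: (f_equal (mulmx^~ ('J f x)) Eg).
exact: (f_equal (fun X => _ + X) Eh).
Qed.

(* The pullback connection is compatible with the pullback of h, which by
   conformality is c times the metric induced by g on the gradients. *)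
Lemma grad_sff_mx (c : 'rV[R]_d -> R) u :
  (forall y, U y ->
     grad (g y) ('J f y) *m 'J f y = c y *: invmx (h (f y))) ->
  differentiable c x ->
  grad (g x) ('J f x) *m sff_mx u + (grad (g x) ('J f x) *m sff_mx u)^T =
  'D_u c x *: invmx (h (f x)).
Proof.
move=> confU dc.
have ax := U_cod Ux; have bx := U_map Ux.
have dJ := differentiable_jacobian.
have df := smooth_differentiable f_smooth Ux.
have dg : differentiable g x := smooth_differentiable (gram_smooth gM a) ax.
have dh : differentiable h (f x) := smooth_differentiable (gram_smooth gN b) bx.
have gu : \forall y \near x, g y \in unitmx.
  by apply: filterS nbhs_dom => y Uy; apply: gram_unit; exact: U_cod.
have hu : \forall y \near x, h (f y) \in unitmx.
  by apply: filterS nbhs_dom => y Uy; apply: gram_unit; exact: U_map.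
have gux := nbhs_singleton gu; have hux := nbhs_singleton hu.
have dhf : differentiable (fun y => h (f y)) x.
  exact: (@differentiable_comp _ _ _ _ f h).
have dig := differentiable_invmx gux dg.
have dih : differentiable (fun y => invmx (h (f y))) x.
  exact: (@differentiable_invmx _ _ _ (fun y => h (f y)) x hux dhf).
have dJT := differentiable_trmx dJ.
have gs : (g x)^T = g x by exact: gram_sym.
have hs : (h (f x))^T = h (f x) by exact: gram_sym.
have := grad_tr ('J f x) gs.
set A := 'J f x; set K := invmx (g x); set H' := invmx (h (f x)).
set B := grad (g x) A => BT.
set DA := 'D_u (jacobian f) x.
have BE : B = A^T *m K by [].
have PE : B *m A = c x *: H' by exact: confU.
set Gm := gamma_mx g x u; set Gn := gamma_mx h (f x) (u *m A).
(* First computation of this derivative: the product rule, with the derivative of the source metric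
   expressed through [Gm]. *)
have P1 : 'D_u (fun y => grad (g y) ('J f y) *m 'J f y) x =
    DA^T *m B^T + B *m DA - B *m Gm *m A - (B *m Gm *m A)^T.
  rewrite derive_mulmx//; last exact: differentiable_mulmx.
  rewrite /grad derive_mulmx// derive_trmx// derive_invmx// derive_gram//.
  rewrite -/A -/K -/DA -/Gm -/g.
  have -> : K *m (Gm *m g x + g x *m Gm^T) *m K = K *m Gm + Gm^T *m K.
    rewrite mulmxDr mulmxDl; congr (_ + _); first by rewrite !mulmxA mulmxK.
    by rewrite (mulmxA K) mulVmx// mul1mx.
  have -> : (B *m Gm *m A)^T = A^T *m (Gm^T *m K) *m A.
    by rewrite !(trmx_mul _ A) (trmx_mul B) BT !mulmxA.
  rewrite BT mulmxN mulmxDr mulmxDl mulNmx mulmxDl !mulmxA -BE.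
  by rewrite opprD !addrA [LHS]addrC !addrA [X in X - _ - _]addrC.
(* Second computation, from conformality and the derivative of the target metric; comparison with
   [P1] gives the claim. *)
have P2 : 'D_u (fun y => grad (g y) ('J f y) *m 'J f y) x =
    'D_u c x *: H' - B *m A *m Gn - (B *m A *m Gn)^T.
  rewrite (near_eq_derive _ (g := fun y => c y *: invmx (h (f y)))); last first.
    by apply: filterS nbhs_dom => y Uy; exact: confU.
  rewrite derive_scalemx// (@derive_invmx _ _ _ (fun y => h (f y)) x u hu dhf).
  rewrite (derive_comp _ df dh).
  rewrite (derive_jacobian _ Ux) -/A derive_gram// -/Gn -/h -/H' -!addrA.
  congr (_ + _); rewrite scalerN mulmxDr mulmxDl scalerDr opprD.
  congr (- _ - _).
    by rewrite PE -!scalemxAl -!mulmxA mulmxV ?mulmx1.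
  rewrite trmx_mul PE linearZ /= trmx_inv hs -/H' -scalemxAr !mulmxA.
  by rewrite mulVmx ?mul1mx.
have SE : B *m sff_mx u = B *m DA + B *m A *m Gn - B *m Gm *m A.
  by rewrite /sff_mx mulmxBr mulmxDr !mulmxA.
rewrite SE; move: P1; rewrite P2 -trmx_mul.
set X := 'D_u c x *: H'; set X1 := B *m A *m Gn; set X2 := B *m Gm *m A.
set X3 := B *m DA; clearbody X X1 X2 X3 => E.
rewrite -[RHS](subrK X1) -[X - X1](subrK X1^T) E linearB linearD /=.
by apply/matrixP => i j; rewrite !mxE; ring.
Qed.

End SecondFundamentalForm.

(** * The algebra behind the horizontal trace *)

Section HorizontalTrace.
Local Open Scope ring_scope.

(** In the application [s i j k] is the [k]-th component of the second fundamental form on the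
    gradients [i] and [j], and [w i] is the derivative of the squared dilation along gradient [i].
    In dimension [e] twice the trace is [(2 - e) * w k]. *)
Lemma symmetric_trace_eq0 (R : realType) (e : nat) (H : 'M[R]_e)
    (s : 'I_e -> 'I_e -> 'I_e -> R) (w : 'I_e -> R) :
  e = 2 -> H \in unitmx -> H^T = H ->
  (forall i j k, s i j k = s j i k) ->
  (forall i j k, s i j k + s i k j = w i * invmx H j k) ->
  forall k, \sum_i \sum_j H i j * s i j k = 0.
Proof.
move=> e2 Hu Hs sC sD k; set H' := invmx H in sD.
have H's : H'^T = H' by rewrite trmx_inv Hs.
have H'C i j : H' i j = H' j i by rewrite -[in LHS]H's mxE.
have HC i j : H i j = H j i by rewrite -[in LHS]Hs mxE.
have HH' i j : \sum_k H i k * H' k j = (i == j)%:R.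
  by have := mulmxV Hu; move=> /matrixP/(_ i j); rewrite !mxE.
(* Koszul's trick: add the relations starting with [i] and with [j], subtract the one starting with
   [k], and cancel by symmetry. *)
have s2 i j : 2 * s i j k = w i * H' j k + w j * H' i k - w k * H' i j.
  rewrite -!sD (sC j i k) (sC k i j) (sC k j i); ring.
have S1 : \sum_i \sum_j H i j * (w i * H' j k) = w k.
  rewrite (bigD1 k)//= [X in _ + X]big1 ?addr0 => [|i ik].
    under eq_bigr do rewrite mulrCA.
    by rewrite -mulr_sumr HH' eqxx mulr1.
  under eq_bigr do rewrite mulrCA.
  by rewrite -mulr_sumr HH' (negbTE ik) mulr0.
have S2 : \sum_i \sum_j H i j * (w j * H' i k) = w k.
  rewrite exchange_big /= -[RHS]S1.
  by apply: eq_bigr => j _; apply: eq_bigr => i _; rewrite HC.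
(* Contracting [H] with its inverse gives the trace of the identity; this is where [e = 2]
   enters. *)
have S3 : \sum_i \sum_j H i j * (w k * H' i j) = 2 * w k.
  under eq_bigr do under eq_bigr do rewrite mulrCA H'C.
  under eq_bigr do rewrite -mulr_sumr HH' eqxx mulr1.
  by rewrite sumr_const card_ord e2 mulr_natl.
apply: (@mulfI _ 2); first by rewrite pnatr_eq0.
rewrite mulr0 mulr_sumr; under eq_bigr do rewrite mulr_sumr.
transitivity (w k + w k - 2 * w k); last by ring.
rewrite -{1}S1 -{1}S2 -S3 -big_split -sumrB; apply: eq_bigr => i _ /=.
rewrite -big_split -sumrB; apply: eq_bigr => j _ /=.
by rewrite mulrCA s2; ring.
Qed.

End HorizontalTrace.

(** * Tension field and mean curvature in charts *)

Section LocalTension.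
Local Open Scope classical_set_scope.
Local Open Scope ring_scope.
Context {R : realType} {d e : nat} {M : manifold R d} {N : manifold R e}.
Variables (gM : riemannian_metric M) (gN : riemannian_metric N).
Variables (a : atlas M) (b : atlas N) (f : 'rV[R]_d -> 'rV[R]_e).
Variable U : set 'rV[R]_d.
Hypothesis U_open : open U.
Hypothesis U_cod : forall y, U y -> cod a y.
Hypothesis U_map : forall y, U y -> cod b (f y).
Hypothesis f_smooth : smooth U f.
Hypothesis f_full : forall y, U y -> row_full ('J f y).

Let g := gM a.
Let h := gN b.
Let B y := grad (g y) ('J f y).

Lemma gramM_pos y : U y ->
  forall u : 'rV[R]_d, u != 0 -> 0 < (u *m g y *m u^T) 0 0.
Proof. by move=> Uy u; apply: gram_pos; exact: U_cod. Qed.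

Lemma gramM_sym y : U y -> (g y)^T = g y.
Proof. by move=> Uy; apply: gram_sym; exact: U_cod. Qed.

(** Conformality on the gradients, whose Gram matrix is [P], reads
    [l ^+ 2 *: P = P *m h (f y) *m P]; cancelling one factor [P] determines the other. *)
Lemma conformal_grad y l : U y -> 0 < l ->
  (forall X Y : 'rV[R]_d,
    (X <= hor g f y)%MS -> (Y <= hor g f y)%MS ->
    l ^+ 2 * inner (g y) X Y =
    inner (h (f y)) (X *m 'J f y) (Y *m 'J f y)) ->
  B y *m 'J f y = l ^+ 2 *: invmx (h (f y)).
Proof.
move=> Uy l0 conf; set A := 'J f y; set P := B y *m A.
have gs := gramM_sym Uy; have gp := gramM_pos Uy.
have Pu : P \in unitmx by exact: grad_mul_unit gs gp (f_full Uy).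
have hu : h (f y) \in unitmx by apply: gram_unit; exact: U_map.
have PT : P^T = P by exact: grad_mul_sym.
have E : l ^+ 2 *: P = P *m h (f y) *m P^T.
  apply/matrixP => i j.
  have Bsub k : (row k (B y) <= hor g f y)%MS.
    by apply: submx_trans (row_sub _ _) _; exact: grad_sub_perp.
  have := conf _ _ (Bsub i) (Bsub j); rewrite /inner -!row_mul -/A -/P.
  rewrite !tr_row.
  have rc n (X : 'M[R]_(e, n)) (Y : 'M[R]_(n, e)) :
      row i (X *m col j Y) 0 0 = (X *m Y) i j.
    by rewrite colE mulmxA -colE [LHS]mxE mxE.
  by rewrite !rc /B grad_gram_grad// => <-; rewrite [LHS]mxE.
rewrite PT in E; have {}E : l ^+ 2 *: 1%:M = P *m h (f y).
  by rewrite -(mulmxK Pu (P *m h (f y))) -E -scalemxAl mulmxV.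
by rewrite -(mulmxK hu P) -E -scalemxAl mul1mx.
Qed.

Hypothesis e2 : e = 2.
Variable c : 'rV[R]_d -> R.
Hypothesis c_pos : forall y, U y -> 0 < c y.
Hypothesis f_conf : forall y, U y -> B y *m 'J f y = c y *: invmx (h (f y)).
Variable x : 'rV[R]_d.
Hypothesis Ux : U x.

Let S u := sff_mx gM gN a b f x u.
Let A := 'J f x.

Lemma differentiable_grad : differentiable B x.
Proof.
apply: differentiable_mulmx.
  by apply: differentiable_trmx; apply: differentiable_jacobian Ux.
apply: differentiable_invmx; first by apply: gram_unit; exact: U_cod.
exact: smooth_differentiable (gram_smooth gM a) (U_cod Ux).
Qed.

(** Regularity of [c] is recovered from [f_conf], by which [c] is a diagonal entry of
    [B y *m 'J f y *m h (f y)]; such an entry exists since [e = 2]. *)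
Lemma differentiable_dilation : differentiable c x.
Proof.
have dJ : differentiable (jacobian f) x by apply: differentiable_jacobian Ux.
have i : 'I_e by rewrite e2; exact: ord0.
have dhf : differentiable (fun y => h (f y)) x.
  apply: (@differentiable_comp _ _ _ _ f h).
    exact: smooth_differentiable Ux.
  exact: smooth_differentiable (gram_smooth gN b) (U_map Ux).
apply: (@near_eq_differentiable _ _ _
    (fun y => (B y *m 'J f y *m h (f y)) i i)); last first.
  apply: differentiable_coef; apply: differentiable_mulmx dhf.
  exact: differentiable_mulmx differentiable_grad dJ.
apply: filterS (nbhs_dom U_open Ux) => y Uy.
rewrite f_conf// -scalemxAl mulVmx; last by apply: gram_unit; exact: U_map.
by rewrite !mxE eqxx mulr1.
Qed.

Lemma horizontal_trace_eq0 :
  metric_trace (g x) (B x) (fun u v => v *m S u) = 0.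
Proof.
have hu : h (f x) \in unitmx by apply: gram_unit; exact: U_map.
have hs : (h (f x))^T = h (f x) by apply: gram_sym; exact: U_map.
have gs := gramM_sym Ux; have gp := gramM_pos Ux.
have c0 : c x != 0 by rewrite gt_eqF// c_pos.
(* The Gram matrix of the gradients is [c x *: invmx (h (f x))], so the weights of the trace are
   those of [h (f x)] up to a scalar. *)
have PE : invmx (B x *m g x *m (B x)^T) = (c x)^-1 *: h (f x).
  rewrite /B grad_gram_grad// -/(B x) f_conf//.
  by rewrite invmxZ ?invmxK// unitmxZ ?unitfE// unitmx_inv.
apply/rowP => k; rewrite /metric_trace PE summxE mxE.
under eq_bigr => i _ do rewrite summxE.
pose s i j k := (B x *m S (row i (B x))) j k.
transitivity ((c x)^-1 * \sum_i \sum_j h (f x) i j * s i j k).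
  rewrite mulr_sumr; apply: eq_bigr => i _; rewrite mulr_sumr.
  apply: eq_bigr => j _; rewrite -row_mul [LHS]mxE [X in X * _]mxE.
  by rewrite [X in _ * X]mxE mulrA.
rewrite (@symmetric_trace_eq0 _ _ _ s (fun i => 'D_(row i (B x)) c x))//.
- by rewrite mulr0.
- move=> i j l; rewrite /s.
  have rE (X : 'M[R]_e) p q : X p q = row p X 0 q by rewrite mxE.
  rewrite !rE (row_mul j (B x)) (row_mul i (B x)).
  apply: (f_equal (fun X : 'rV[R]_e => X 0 l)).
  exact: (sff_mxC gM gN U_open U_cod U_map f_smooth Ux).
- move=> i j l.
  have := grad_sff_mx U_open U_cod U_map f_smooth Ux (row i (B x)) f_conf
    differentiable_dilation.
  move=> /matrixP/(_ j l) E; apply: etrans (etrans _ E) _.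
    by rewrite [RHS]mxE; congr (_ + _); rewrite [RHS]mxE.
  by rewrite [LHS]mxE.
Qed.

(** Comes from differentiating [V *m 'J f = 0] along [u], for the vertical field [V] extending [v];
    the horizontal projection disappears because [hproj *m A = A]. *)
Lemma fibre_sff_mul u v : u *m A = 0 -> v *m A = 0 ->
  fibre_sff g f x u v *m A = - (v *m S u).
Proof.
move=> uA vA; have gs := gramM_sym Ux; have gp := gramM_pos Ux.
have dJ : differentiable (jacobian f) x by apply: differentiable_jacobian Ux.
have vpE y w : U y -> vert_part g f (cst w) y =
    w *m (1%:M - hproj (g y) ('J f y)).
  move=> Uy; rewrite /vert_part /hor /vert proj_vert_mx//.
  - exact: gramM_sym.
  - exact: gramM_pos.
  - exact: f_full.
have vpx w : w *m A = 0 -> vert_part g f (cst w) x = w.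
  move=> wA; rewrite vpE// mulmxBr mulmx1 /hproj -/A !mulmxA wA !mul0mx.
  by rewrite subr0.
rewrite /fibre_sff /hor_part -mulmxA /hor /vert proj_hor_mx ?hproj_mul//;
  try exact: f_full.
rewrite /nabla !vpx// mulmxDl.
(* The field is defined pointwise through [proj_mx]; its differentiability is read off the closed
   form [vpE], valid on [U]. *)
have dV : differentiable (vert_part g f (cst v)) x.
  apply: (@near_eq_differentiable _ _ _
      (fun y => cst v y *m (1%:M - hproj (g y) ('J f y)))).
    by apply: filterS (nbhs_dom U_open Ux) => y Uy; rewrite vpE.
  apply: differentiable_mulmx; first exact: differentiable_cst.
  apply: differentiableB; first exact: differentiable_cst.
  apply: differentiable_mulmx differentiable_grad.
  apply: differentiable_mulmx => //.
  apply: differentiable_invmx; first exact: grad_mul_unit gs gp (f_full Ux).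
  exact: differentiable_mulmx differentiable_grad dJ.
have : 'D_u (fun y => vert_part g f (cst v) y *m 'J f y) x = 0.
  rewrite -[RHS](derive_cst 0 x u); apply: near_eq_derive.
  apply: filterS (nbhs_dom U_open Ux) => y Uy; rewrite (vpE y v Uy).
  rewrite -mulmxA mulmxBl mul1mx hproj_mul ?subrr ?mulmx0//.
  - exact: gramM_sym.
  - exact: gramM_pos.
  - exact: f_full.
rewrite derive_mulmx// vpx// => /eqP; rewrite addr_eq0 => /eqP ->.
rewrite /S /sff_mx -/A !mulmxBr !mulmxDr (mulmxA v A) vA mul0mx addr0.
by rewrite opprB gammaE -mulmxA addrC.
Qed.

Lemma fibre_sff_sub u v : (fibre_sff g f x u v <= perp (g x) (kermx A))%MS.
Proof. exact: proj_mx_sub. Qed.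

(** Once the horizontal trace is gone, the tension is minus the image by [A] of the trace defining
    the mean curvature, and [A] is injective on horizontal vectors. *)
Lemma tension_eq0 :
  tension g h f x = 0 <-> mean_curvature g f x = 0.
Proof.
have gs := gramM_sym Ux; have gp := gramM_pos Ux.
set k := \rank (kermx A).
set V := row_base (kermx A).
have Vker i : row i V *m A = 0.
  by apply/sub_kermxP; rewrite (submx_trans (row_sub _ _))// eq_row_base.
have tauE : tension g h f x = metric_trace (g x) V (fun u v => v *m S u).
  have Slin := sff_mx_linear gM gN a b U_open f_smooth Ux.
  have nablaE : (fun u v => nabla_push g h f (cst u) (cst v) x) =
      (fun u v => v *m S u).
    apply/funext => u; apply/funext => v.
    exact: (nabla_pushE gM gN a b U_open f_smooth Ux).
  rewrite /tension nablaE (metric_trace_split _ _ gs gp (f_full Ux)).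
  - by rewrite horizontal_trace_eq0 addr0.
  - by move=> v l u w; rewrite /S Slin mulmxDr -scalemxAr.
  - by move=> u l v w; rewrite mulmxDl -scalemxAl.
have HA : metric_trace (g x) V (fibre_sff g f x) *m A = - tension g h f x.
  rewrite tauE /metric_trace mulmx_suml -sumrN; apply: eq_bigr => i _.
  rewrite mulmx_suml -sumrN; apply: eq_bigr => j _.
  by rewrite -scalemxAl fibre_sff_mul// scalerN.
have Hsub : (metric_trace (g x) V (fibre_sff g f x) <= perp (g x) (kermx A))%MS.
  apply: summx_sub => i _; apply: summx_sub => j _.
  by apply: scalemx_sub; exact: fibre_sff_sub.
rewrite /mean_curvature /vert -/A -/V -/k; split=> [t0|/eqP].
  suff -> : metric_trace (g x) V (fibre_sff g f x) = 0 by rewrite scaler0.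
  by apply: (perp_mul_eq0 gp Hsub); rewrite HA t0 oppr0.
(* When the fibres have dimension 0 the normalising factor is [0^-1 = 0], but then the vertical
   trace is an empty sum. *)
rewrite scaler_eq0 invr_eq0 pnatr_eq0 => /orP[/eqP k0|/eqP H0].
  rewrite tauE /metric_trace big1// => i _.
  by exfalso; have := leq_ltn_trans (leq0n i) (ltn_ord i); rewrite -/k k0.
by apply/eqP; rewrite -oppr_eq0 -HA H0 mul0mx.
Qed.

End LocalTension.

(** * From charts to the manifolds *)

Lemma loc_dom_open (R : realType) (d e : nat) (M : manifold R d)
    (N : manifold R e) (F : M -> N) a b :
  continuous F -> open (loc_dom F a b).
Proof.
move=> cF; rewrite openE => x [ax bx].
apply: filterI; first by apply: open_nbhs_nbhs; split=> //; exact: cod_open.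
have Fb : nbhs (psi a x) (F @^-1` dom b)%classic.
  by apply: cF; apply: open_nbhs_nbhs; split=> //; exact: dom_open.
exact: (psi_continuous ax Fb).
Qed.

Theorem corollary4p1 (R : realType) (m n r : nat)
  (M : manifold R (2 * (m + n + r))) (N : manifold R (n + 2 * r))
  (gM : riemannian_metric M) (J : tensor11 M) (gN : riemannian_metric N)
  (F : M -> N)
  (hK : kahler gM J)
  (hF : conformal_semi_invariant_submersion F gM gN m n r J)
  (hnr : (n + 2 * r = 2)%N) :
  harmonic_map F gM gN <-> minimal_fibres F gM.
Proof.
have [[[cF sF] fullF] [lambda [lambda_pos conf]] _] := hF.
have tension_mean a b x : loc_dom F a b x ->
    tension (gM a) (gN b) (loc F a b) x = 0%R <->
    mean_curvature (gM a) (loc F a b) x = 0%R.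
  have Uo : open (loc_dom F a b) by exact: loc_dom_open.
  have Uc y : loc_dom F a b y -> cod a y by case.
  have Um y : loc_dom F a b y -> cod b (loc F a b y).
    by case=> _; exact: phi_cod.
  have Uf y (Uy : loc_dom F a b y) := fullF a b y Uy.
  (* The factor [c] is the squared dilation read in the chart [a]; [conformal_grad] supplies the
     relation required of it. *)
  apply: (tension_eq0 Uo Uc Um (sF a b) Uf hnr
    (c := fun y => (lambda (psi a y) ^+ 2)%R)) => y Uy.
    by rewrite exprn_gt0.
  exact: (conformal_grad Uc Um Uf Uy (lambda_pos _) (conf a b y Uy)).
by split=> H a b x Ux; apply/tension_mean => //; exact: H.
Qed.
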